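(* Let $E\subset X$ be a set of finite perimeter and write $u:=\chi_E$. Let $\varepsilon>0$ and let $G\subset X$ be an open set with $\mathrm{Cap}_1(G)<\varepsilon$ such that whenever $y_k\to x$ with $y_k,x\in X\setminus G$, we have $\min_{l_2\in\{1,\ldots,n\}}|u^{l_1}(y_k)-u^{l_2}(x)|\to0$ for each $l_1=1,\ldots,n$. Then \[ \partial_{X\setminus G}\,\mathcal I(E)\subset\partial^*E\setminus G, \] and both $\partial_{X\setminus G}\,\mathcal I(E)$ and $\partial^*E\setminus G$ are closed subsets of $X$.
   Context: Standing assumptions: $(X,d,\mu)$ is a complete metric space with a Borel regular outer measure $\mu$ that is doubling (there is $C_d\ge 1$ with $0<\mu(B(x,2r))\le C_d\,\mu(B(x,r))<\infty$ for all $x\in X$, $r>0$) and supports a $(1,1)$-Poincaré inequality: there are $C_P>0$, $\lambda\ge 1$ such that for every ball $B(x,r)$, every locally integrable $u$ on $X$ and every upper gradient $g$ of $u$, $\frac{1}{\mu(B(x,r))}\int_{B(x,r)}|u-u_{B(x,r)}|\,d\mu\le C_P\, r\,\frac{1}{\mu(B(x,\lambda r))}\int_{B(x,\lambda r)}g\,d\mu$, where $u_B=\frac1{\mu(B)}\int_B u\,d\mu$. A curve is a rectifiable continuous map from a compact interval into $X$, parametrized by arc length. A nonnegative Borel function $g$ is an upper gradient of an extended real-valued function $u$ if $|u(x)-u(y)|\le\int_\gamma g\,ds$ for all curves $\gamma$ with end points $x,y$ (with $|u(x)-u(y)|=\infty$ if at least one of the values is infinite). For $u\in L^1_{\mathrm{loc}}(X)$,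 $\|Du\|(X):=\inf\{\liminf_{i}\int_X g_{u_i}\,d\mu: u_i\in \mathrm{Lip}_{\mathrm{loc}}(X),\ u_i\to u \text{ in } L^1_{\mathrm{loc}}(X)\}$, each $g_{u_i}$ being an upper gradient of $u_i$. A measurable $E\subset X$ is of finite perimeter if $\|D\chi_E\|(X)<\infty$. Capacity: $\|u\|_{N^{1,1}(X)}:=\|u\|_{L^1(X)}+\inf_g\|g\|_{L^1(X)}$, inf over upper gradients $g$ of $u$; $\mathrm{Cap}_1(A):=\inf\|u\|_{N^{1,1}(X)}$ over $u\in N^{1,1}(X)$ (functions with finite norm) with $u\ge 1$ in a neighborhood of $A$. Codimension $1$ Hausdorff measure: $\mathcal H_R(A):=\inf\{\sum_i \mu(B(x_i,r_i))/r_i: A\subset\bigcup_i B(x_i,r_i),\ r_i\le R\}$, $\mathcal H(A):=\lim_{R\to0^+}\mathcal H_R(A)$. Measure theoretic interior and boundary: $\mathcal I(E):=\{x\in X:\lim_{r\to0^+}\mu(B(x,r)\cap E)/\mu(B(x,r))=1\}$; $\partial^*E$ is the set of points at which both $E$ and $X\setminus E$ have positive upper density. For $A,F\subset X$, $\partial_AF$ denotes the boundary of $F\cap A$ in the subspace topology of $A$. The number $\gamma\in(0,1/2]$ is a fixed constant, depending only on $C_d,C_P,\lambda$, such that for every $E\subset X$ of finite perimeter and $\mathcal H$-a.e. $x\in\partial^*E$, $\gamma\le\liminf_{r\to0^+}\frac{\mu(E\cap B(x,r))}{\mu(B(x,r))}\le\limsup_{r\to0^+}\frac{\mu(E\cap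 B(x,r))}{\mu(B(x,r))}\le1-\gamma$ (such $\gamma$ is known to exist). Put $n:=\lfloor 1/\gamma\rfloor$. Approximate limits and jump values: $u^\wedge(x):=\sup\{t\in\overline{\mathbb R}:\lim_{r\to0^+}\frac{\mu(B(x,r)\cap\{u<t\})}{\mu(B(x,r))}=0\}$, $u^\vee(x):=\inf\{t\in\overline{\mathbb R}:\lim_{r\to0^+}\frac{\mu(B(x,r)\cap\{u>t\})}{\mu(B(x,r))}=0\}$; $u^1:=u^\wedge$, $u^n:=u^\vee$, and inductively for $l=2,\ldots,n-1$, $u^l(x):=\sup\{t\in\overline{\mathbb R}:\lim_{r\to0^+}\frac{\mu(B(x,r)\cap\{u^{l-1}(x)+\delta<u<t\})}{\mu(B(x,r))}=0\ \ \forall\,\delta>0\}$ if $u^{l-1}(x)<u^\vee(x)$, and $u^l(x):=u^\vee(x)$ otherwise. *)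

(* Defs.v *)
From HB Require Import structures.
From mathcomp Require Import all_boot all_order all_algebra.
From mathcomp Require Import all_classical all_reals all_analysis.
From mathcomp Require Import measurable_realfun.

Set Implicit Arguments.
Unset Strict Implicit.
Unset Printing Implicit Defensive.

Import Order.TTheory GRing.Theory Num.Theory.
Import numFieldNormedType.Exports.

Local Open Scope classical_set_scope.
Local Open Scope ring_scope.
Local Open Scope ereal_scope.

(* The distinguished point inherited from [Complete] only says that the space
   is nonempty. *)
#[short(type="completeMetricType")]
HB.structure Definition CompleteMetric (R : numDomainType) :=
  { T of Complete T & Metric R T }.

Section Curves.
Context {R : realType} {X : completeMetricType R}.

Definition curve_length (c : R -> X) (a b : R) : \bar R :=
  ereal_sup [set (\sum_(0 <= i < size s)
                   mdist (nth (c b) (map c (a :: s)) i)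
                         (nth (c b) (map c (a :: s)) i.+1))%R%:E
            | s in itv_partition a b].

(* [c], restricted to [0, l], is a (nonconstant) rectifiable curve parametrized
   by arc length; its values outside [0, l] are irrelevant. *)
Definition arclength_curve (c : R -> X) (l : R) : Prop :=
  [/\ (0 < l)%R,
      {within `[0%R, l], continuous c} &
      forall s t : R, (0 <= s)%R -> (s <= t)%R -> (t <= l)%R ->
        curve_length c s t = (t - s)%:E].

Definition borel_set (A : set X) : Prop := <<s @open X >> A.

Definition borel_fun (g : X -> \bar R) : Prop :=
  measurable_fun [set: g_sigma_algebraType (@open X)]
    (g : g_sigma_algebraType (@open X) -> \bar R).

(* On [\bar R], [+oo - +oo = -oo - -oo = -oo], so that [`|u x - u y|] is [+oo]
   as soon as one of [u x], [u y] is infinite. *)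
Definition upper_gradient (g u : X -> \bar R) : Prop :=
  [/\ borel_fun g,
      forall x, 0 <= g x &
      forall (c : R -> X) (l : R), arclength_curve c l ->
        `|u (c 0%R) - u (c l)|
          <= \int[lebesgue_measure]_(t in `[0%R, l]) g (c t)].

End Curves.

Section MeasureOnMetricSpace.
Context {R : realType} {X : completeMetricType R}.
Variable mu : {outer_measure set X -> \bar R}.

(* The complete measure induced by [mu] on its Caratheodory-measurable sets:
   "measurable", "integrable" and integrals always refer to it. *)
Definition cara_measure : {measure set (caratheodory_type mu) -> \bar R} :=
  (mu : set (caratheodory_type mu) -> \bar R).

Definition mu_measurable_fun (u : X -> \bar R) : Prop :=
  measurable_fun [set: caratheodory_type mu]
    (u : caratheodory_type mu -> \bar R).

Definition mu_int (A : set X) (u : X -> \bar R) : \bar R :=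
  \int[cara_measure]_(x in (A : set (caratheodory_type mu))) u x.

Definition mu_avg (A : set X) (u : X -> \bar R) : \bar R :=
  mu_int A u / mu A.

Definition borel_regular : Prop :=
  (forall A : set X, borel_set A -> mu.-cara.-measurable A) /\
  (forall A : set X, exists B : set X,
     [/\ borel_set B, A `<=` B & mu B = mu A]).

Definition doubling (Cd : R) : Prop :=
  (1 <= Cd)%R /\
  forall (x : X) (r : R), (0 < r)%R ->
    [/\ 0 < mu (ball x (2 * r)%R),
        mu (ball x (2 * r)%R) <= Cd%:E * mu (ball x r) &
        Cd%:E * mu (ball x r) < +oo].

(* A complete doubling space is proper, so "locally" means "on every compact
   set". *)
Definition L1loc (u : X -> \bar R) : Prop :=
  mu_measurable_fun u /\
  forall K : set X, compact K -> mu_int K (fun x => `|u x|) < +oo.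

Definition cvg_L1loc (u_ : nat -> X -> \bar R) (u : X -> \bar R) : Prop :=
  forall K : set X, compact K ->
    mu_int K (fun x => `|u_ i x - u x|) @[i --> \oo] --> 0.

Definition Lip_loc (u : X -> R) : Prop :=
  forall K : set X, compact K ->
    exists L : R, forall x y, K x -> K y ->
      (`|u x - u y| <= L * mdist x y)%R.

Definition poincare (CP lambda : R) : Prop :=
  [/\ (0 < CP)%R, (1 <= lambda)%R &
      forall (x : X) (r : R), (0 < r)%R ->
      forall u g : X -> \bar R, L1loc u -> upper_gradient g u ->
        mu_avg (ball x r) (fun y => `|u y - mu_avg (ball x r) u|)
          <= (CP * r)%:E * mu_avg (ball x (lambda * r)%R) g].

Definition total_variation (u : X -> \bar R) : \bar R :=
  ereal_inf [set v | exists (u_ : nat -> X -> R) (g_ : nat -> X -> \bar R),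
    [/\ forall i, Lip_loc (u_ i),
        forall i, upper_gradient (g_ i) (EFin \o u_ i),
        cvg_L1loc (fun i => EFin \o u_ i) u &
        v = limn_einf (fun i => mu_int setT (g_ i))]].

Definition chi (E : set X) : X -> \bar R := EFin \o \1_E.

Definition finite_perimeter (E : set X) : Prop :=
  mu.-cara.-measurable E /\ total_variation (chi E) < +oo.

Definition N11_norm (u : X -> \bar R) : \bar R :=
  mu_int setT (fun x => `|u x|) +
  ereal_inf [set mu_int setT g | g in [set g | upper_gradient g u]].

Definition N11 (u : X -> \bar R) : Prop :=
  mu_measurable_fun u /\ N11_norm u < +oo.

Definition Cap1 (A : set X) : \bar R :=
  ereal_inf [set N11_norm u | u in [set u | N11 u /\
    exists U : set X, [/\ open U, A `<=` U & forall y, U y -> 1 <= u y]]].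

(* Coverings are finite or countable, hence the index set [I]: a finite covering
   cannot in general be completed to an infinite one at no cost. *)
Definition codim1_hausdorff_content (R0 : R) (A : set X) : \bar R :=
  ereal_inf [set v | exists (I : set nat) (x : nat -> X) (r : nat -> R),
    [/\ forall i, I i -> (0 < r i <= R0)%R,
        A `<=` \bigcup_(i in I) ball (x i) (r i) &
        v = \esum_(i in I) (mu (ball (x i) (r i)) / (r i)%:E)]].

Definition codim1_hausdorff (A : set X) : \bar R :=
  lim (codim1_hausdorff_content R0 A @[R0 --> 0%R^'+]).

Definition dens (A : set X) (x : X) (r : R) : \bar R :=
  mu (ball x r `&` A) / mu (ball x r).

Definition upper_dens (A : set X) (x : X) : \bar R :=
  limf_esup (dens A x) 0%R^'+.

Definition lower_dens (A : set X) (x : X) : \bar R :=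
  limf_einf (dens A x) 0%R^'+.

Definition meas_interior (E : set X) : set X :=
  [set x | dens E x r @[r --> 0%R^'+] --> 1].

Definition meas_boundary (E : set X) : set X :=
  [set x | 0 < upper_dens E x /\ 0 < upper_dens (~` E) x].

Definition perimeter_density_bound (gamma : R) : Prop :=
  forall E : set X, finite_perimeter E ->
    codim1_hausdorff [set x | meas_boundary E x /\
      ~ (gamma%:E <= lower_dens E x /\ upper_dens E x <= (1 - gamma)%:E)] = 0.

Definition approx_inf (u : X -> \bar R) (x : X) : \bar R :=
  ereal_sup [set t | dens [set y | u y < t] x r @[r --> 0%R^'+] --> 0].

Definition approx_sup (u : X -> \bar R) (x : X) : \bar R :=
  ereal_inf [set t | dens [set y | t < u y] x r @[r --> 0%R^'+] --> 0].

(* [jump_rec u k x] is the recursion for u^(k+1)(x), k+1 < n. *)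
Fixpoint jump_rec (u : X -> \bar R) (k : nat) (x : X) : \bar R :=
  if k is k'.+1 then
    let v := jump_rec u k' x in
    if v < approx_sup u x then
      ereal_sup [set t | forall delta : R, (0 < delta)%R ->
        dens [set y | v + delta%:E < u y < t] x r @[r --> 0%R^'+] --> 0]
    else approx_sup u x
  else approx_inf u x.

(* u^l(x) for 1 <= l <= n, where n >= 2. *)
Definition jump_value (n : nat) (u : X -> \bar R) (l : nat) (x : X) : \bar R :=
  if l == n then approx_sup u x else jump_rec u l.-1 x.

End MeasureOnMetricSpace.

(* The boundary of F `&` A in the subspace topology of A. In the library's
   [subspace A] the points outside A are isolated, so none of them belongs to
   this boundary. *)
Definition rel_boundary {T : topologicalType} (A F : set T) : set T :=
  closure (F `&` A : set (subspace A)) `\`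
  interior (F `&` A : set (subspace A)).

(* Main.v *)
Require Import Defs.
From HB Require Import structures.
From mathcomp Require Import all_boot all_order all_algebra.
From mathcomp Require Import all_classical all_reals all_analysis.
From mathcomp Require Import measurable_realfun.

Set Implicit Arguments.
Unset Strict Implicit.
Unset Printing Implicit Defensive.

Import Order.TTheory GRing.Theory Num.Theory.
Import numFieldNormedType.Exports.

Local Open Scope classical_set_scope.
Local Open Scope ring_scope.
Local Open Scope ereal_scope.

(** At every point, [E] has density one, or density zero, or neither; these are
    the points of the measure theoretic interior, of the measure theoretic
    exterior and of the measure theoretic boundary. The trichotomy can be read
    off the jump values of [chi E]: they are all [1] in the interior and all [0]
    in the exterior, whereas off the interior the first one is [0] and off the
    exterior the last one is [1]
    ([approx_inf_chi_interior], [approx_inf_chi_not_interior],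
    [approx_sup_chi_exterior], [approx_sup_chi_not_exterior]).

    Now let points off [G] converge to a point [x] off [G]. By hypothesis every
    jump value along the sequence approaches the set of jump values at [x]. If
    the points avoid the interior, their first jump value is [0], so that [0] is
    a jump value at [x] and [x] is not in the interior either; if they avoid the
    exterior, their last jump value is [1], and [x] is not in the exterior. In
    other words, off [G] the complements of the interior and of the exterior are
    both relatively closed.

    Consequently their intersection, which is the measure theoretic boundary off
    [G], is closed. A point of the relative boundary of the interior is a limit
    of points of the interior, which avoid the exterior, and of points that
    avoid the interior; hence it lies in the measure theoretic boundary. The
    relative boundary of any set in a closed set is closed. *)

(** * Sequences and relative boundaries *)

Lemma mem_closure_seq (R : realType) (X : pseudoMetricType R) (A : set X)
    (x : X) :
  closure A x -> exists2 y : nat -> X, forall k, A (y k) & y @ \oo --> x.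
Proof.
move=> clAx.
have /choice[y yP] : forall k : nat, exists y, A y /\ ball x k.+1%:R^-1%R y.
  move=> k; have [|y [Ay xy]] := clAx (ball x k.+1%:R^-1%R); last by exists y.
  by apply: nbhsx_ballx; rewrite invr_gt0 ltr0n.
exists y => [k|]; first by have [] := yP k.
apply/cvg_ballP => e e0; near=> k.
apply: (@le_ball _ _ _ k.+1%:R^-1%R); last first.
  by have [] := yP k.
by apply/ltW; near: k; exact: near_infty_natSinv_lt (PosNum e0).
Unshelve. all: by end_near. Qed.

(** The intrinsic boundary in the subspace [A], rewritten with closures in the
    ambient space, which is where sequences are extracted and closedness is
    claimed. *)
Lemma rel_boundaryE (T : topologicalType) (A F : set T) :
  rel_boundary A F = A `&` closure (F `&` A) `&` closure (A `\` F).
Proof.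
apply/seteqP; split=> [x [clx nintx]|x [[Ax clx] clCx]].
- have Ax : A x.
    apply: contrapT => nAx.
    have [|y [[_ Ay] yx]] := clx [set x].
      by case: (nbhs_subspaceP A x) => // _ y ->.
    by apply: nAx; rewrite -yx.
  split; first split => //.
    move=> U Ux; apply: clx; case: (nbhs_subspaceP A x) => // _.
    by apply: filterS Ux => y.
  move=> U Ux; apply: contrapT => /set0P/negP; rewrite negbK => /eqP UF0.
  apply: nintx; rewrite /interior /=; case: (nbhs_subspaceP A x) => // _.
  apply: filterS Ux => y Uy Ay; split=> //; apply: contrapT => nFy.
  by have : ((A `\` F) `&` U) y by []; rewrite UF0.
- split.
    move=> U; case: (nbhs_subspaceP A x) => // _ Ux.
    have [y [[Fy Ay] Uy]] := clx _ Ux.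
    by exists y; split => //; exact: Uy.
  rewrite /interior /=; case: (nbhs_subspaceP A x) => // _ FAx.
  by have [y [[Ay nFy] /(_ Ay)[]]] := clCx _ FAx.
Qed.

Lemma closed_rel_boundary (T : topologicalType) (A F : set T) :
  closed A -> closed (rel_boundary A F).
Proof.
move=> cA; rewrite rel_boundaryE.
by apply: closedI; [apply: closedI => //|]; exact: closed_closure.
Qed.

(** * Upper limits *)

(** Turns positivity of an upper density into failure of convergence to zero,
    the form in which the approximate limits see densities. *)
Lemma limf_esup_le0P (R : realType) (T : choiceType) (X : filteredType T)
    (f : X -> \bar R) (F : set_system X) : ProperFilter F ->
  (forall x, 0 <= f x) -> limf_esup f F <= 0 <-> f @ F --> 0.
Proof.
move=> FF f0; rewrite limf_esupE; split=> [sup0|fF0].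
- have ltf (e : R) : (0 < e)%R -> \forall x \near F, f x < e%:E.
    move=> e0; have /ereal_inf_lt[_ [V FV <-] Ve] :
        ereal_inf [set ereal_sup [set f x | x in V] | V in F] < e%:E.
      by apply: le_lt_trans sup0 _; rewrite lte_fin.
    apply: filterS FV => y Vy; apply: le_lt_trans Ve.
    by apply: ereal_sup_ubound; exists y.
  apply/fine_cvgP; split.
    apply: filterS (ltf 1%R ltr01) => y fy1.
    by rewrite ge0_fin_numE// (lt_trans fy1)// ltry.
  apply/cvgrPdist_lt => e e0; apply: filterS (ltf e e0) => y fye /=.
  rewrite sub0r normrN ger0_norm ?fine_ge0//.
  have : f y \is a fin_num by rewrite ge0_fin_numE// (lt_trans fye)// ltry.
  by move=> /fineK fyE; rewrite -lte_fin fyE.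
- apply/lee_addgt0Pr => e e0; rewrite add0e.
  have Fe : F [set y | f y < e%:E].
    by apply: (fF0 [set z | z < e%:E]); apply: open_ereal_lt'; rewrite lte_fin.
  apply: ge_ereal_inf; exists (ereal_sup [set f y | y in [set y | f y < e%:E]]).
    by exists [set y | f y < e%:E].
  by apply: ge_ereal_sup => _ [y /ltW + <-].
Qed.

(** * Limits of jump values *)

(** The minimum over [m] of the distances to the [v m x] is the distance
    [`|c - d|] for every term of the sequence, so it can only tend to zero by
    vanishing. *)
Lemma const_value_in_limit (R : realType) (X : pseudoMetricType R)
    (n : nat) (v : nat -> X -> \bar R) (A : set X) (x : X) (l : nat) (c d : R) :
  (forall y : nat -> X, (forall k, A (y k)) -> y @ \oo --> x ->
     \big[mine/+oo]_(1 <= m < n.+1) `|v l (y k) - v m x| @[k --> \oo] --> 0) ->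
  (forall y, A y -> v l y = c%:E) ->
  (forall m, (1 <= m <= n)%N -> v m x = d%:E) ->
  closure A x -> c = d.
Proof.
move=> vcvg vA vx /mem_closure_seq[y Ay yx].
have : (`|c - d|)%:E <= 0 :> \bar R.
  apply: (cvge_ge (f := fun k => _) _ (vcvg y Ay yx)).
  apply: nearW => k; rewrite big_nat; apply: le_bigmin => [|m mn].
    by rewrite leey.
  by rewrite vA// vx.
by rewrite lee_fin normr_le0 subr_eq0 => /eqP.
Qed.

(** * Densities and jump values of a characteristic function *)

Section density.
Context {R : realType} {X : completeMetricType R}.
Variables (mu : {outer_measure set X -> \bar R}) (Cd : R).
Hypothesis mu_doubling : doubling mu Cd.
Implicit Types (A B E : set X) (x : X) (r : R).

Definition density0 A x : Prop := dens mu A x r @[r --> 0%R^'+] --> 0.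

Lemma doubling_ball_gt0 x r : (0 < r)%R -> 0 < mu (ball x r).
Proof.
move=> r0; have [_ /(_ x (r / 2)%R)[]] := mu_doubling.
  by rewrite divr_gt0.
by rewrite mulrC divfK.
Qed.

Lemma doubling_ball_fin_num x r : (0 < r)%R -> mu (ball x r) \is a fin_num.
Proof.
move=> r0; have [C1 /(_ x r r0)[_ _]] := mu_doubling.
rewrite ge0_fin_numE ?outer_measure_ge0//; apply: le_lt_trans.
by rewrite lee_pemull ?outer_measure_ge0// lee_fin.
Qed.

Lemma dens_ge0 A x r : 0 <= dens mu A x r.
Proof. by rewrite mule_ge0 ?inve_ge0 ?outer_measure_ge0. Qed.

Lemma le_dens A B x r : A `<=` B -> dens mu A x r <= dens mu B x r.
Proof.
move=> AB; apply: lee_wpmul2r; first by rewrite inve_ge0 outer_measure_ge0.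
by apply: le_outer_measure; exact: setIS.
Qed.

Lemma densT x r : (0 < r)%R -> dens mu setT x r = 1.
Proof.
move=> r0; rewrite /dens setIT divee ?doubling_ball_fin_num//.
by rewrite gt_eqF ?doubling_ball_gt0.
Qed.

Lemma dens_fin_num A x r : (0 < r)%R -> dens mu A x r \is a fin_num.
Proof.
move=> r0; rewrite ge0_fin_numE ?dens_ge0//.
by apply: le_lt_trans (le_dens x r (@subsetT _ A)) _; rewrite densT ?ltry.
Qed.

Lemma densC E x r : mu.-cara.-measurable E -> (0 < r)%R ->
  dens mu (~` E) x r = 1 - dens mu E x r.
Proof.
move=> mE r0.
have <- : dens mu E x r + dens mu (~` E) x r = 1.
  rewrite -(densT x r0) /dens setIT (mE (ball x r)).
  by rewrite ge0_muleDl ?outer_measure_ge0.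
by rewrite addeAC subee ?add0e ?dens_fin_num.
Qed.

Lemma density0S A B x : A `<=` B -> density0 B x -> density0 A x.
Proof.
move=> AB B0; apply: squeeze_cvge (cvg_cst 0) B0.
by apply: nearW => r; rewrite dens_ge0 le_dens.
Qed.

Lemma density0_set0 x : density0 set0 x.
Proof.
rewrite /density0 (_ : dens mu set0 x = cst 0); first exact: cvg_cst.
by apply/funext => r; rewrite /dens setI0 outer_measure0 mul0e.
Qed.

Lemma density0TN x : ~ density0 setT x.
Proof.
move=> T0; have : (1 : \bar R) = 0.
  apply: (cvg_unique _ _ T0) => //.
  apply: cvg_near_cst; near=> r; apply/densT.
  by near: r; exact: nbhs_right_gt.
by move/eqP; rewrite onee_eq0.
Unshelve. all: by end_near. Qed.

(** This is where measurability of [E] enters: the densities of [E] and of its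
    complement add up to one. *)
Lemma meas_interiorP E x : mu.-cara.-measurable E ->
  meas_interior mu E x <-> density0 (~` E) x.
Proof.
have cvgC A B (a : \bar R) :
    (forall r, (0 < r)%R -> dens mu B x r = 1 - dens mu A x r) ->
    dens mu A x r @[r --> 0%R^'+] --> a ->
    dens mu B x r @[r --> 0%R^'+] --> 1 - a.
  move=> AB Aa.
  have : 1 - dens mu A x r @[r --> 0%R^'+] --> 1 - a.
    by apply: cvgeB Aa; [exact: fin_num_adde_defr|exact: cvg_cst].
  apply: cvg_trans; apply: near_eq_cvg.
  by apply: filterS (nbhs_right_gt 0%R) => r r0; rewrite AB.
move=> mE; split=> [E1|E0].
  rewrite /density0 -(subee (x := 1))//.
  by apply: cvgC E1 => // r; exact: densC.
rewrite /meas_interior /= -[1]sube0; apply: cvgC E0 => // r r0.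
by rewrite -densC ?setCK//; exact: measurableC.
Qed.

Lemma upper_dens_gt0P A x : 0 < upper_dens mu A x <-> ~ density0 A x.
Proof.
rewrite /upper_dens ltNge; have [h1 h2] :=
  limf_esup_le0P (at_right_proper_filter 0%R) (dens_ge0 A x).
by split=> [/negP h /h2|h]; [|apply/negP => /h1].
Qed.

Lemma meas_boundaryP E x : mu.-cara.-measurable E ->
  meas_boundary mu E x <-> ~ density0 E x /\ ~ meas_interior mu E x.
Proof.
move=> mE; rewrite /meas_boundary /=.
split=> -[/upper_dens_gt0P E0 EC]; split => //.
  by rewrite meas_interiorP//; apply/upper_dens_gt0P.
by apply/upper_dens_gt0P; rewrite -meas_interiorP.
Qed.

Lemma chi_cases E y : chi E y = 1 /\ E y \/ chi E y = 0 /\ ~ E y.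
Proof.
rewrite /chi /= indicE.
have [/set_mem|/negP] := boolP (y \in E); [left|right] => //.
by split => // /mem_set.
Qed.


(** The four computations below rest on the fact that the sub- and superlevel
    sets of [chi E] are empty, the whole space, [E] or its complement; a level
    is admissible when the corresponding set has density zero, which always
    holds for the empty set and never for the whole space. *)
Lemma approx_inf_chi_interior E x : mu.-cara.-measurable E ->
  meas_interior mu E x -> approx_inf mu (chi E) x = 1.
Proof.
move=> mE /(meas_interiorP _ mE) C0.
apply/eqP; rewrite eq_le; apply/andP; split.
  apply: ge_ereal_sup => t /= tE; rewrite leNgt; apply/negP => t1.
  apply: (@density0TN x); apply: density0S tE => y _ /=.
  by apply: le_lt_trans t1; case: (chi_cases E y) => -[->].
apply: ereal_sup_ubound => /=; apply: density0S C0 => y /=.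
by case: (chi_cases E y) => -[-> //]; rewrite ltxx.
Qed.

Lemma approx_inf_chi_not_interior E x : mu.-cara.-measurable E ->
  ~ meas_interior mu E x -> approx_inf mu (chi E) x = 0.
Proof.
move=> mE nI.
apply/eqP; rewrite eq_le; apply/andP; split.
  apply: ge_ereal_sup => t /= tE; rewrite leNgt; apply/negP => t0.
  apply: nI; apply/(meas_interiorP _ mE); apply: density0S tE => y /= nEy.
  by case: (chi_cases E y) => -[->].
apply: ereal_sup_ubound => /=; apply: density0S (density0_set0 x) => y /=.
by case: (chi_cases E y) => -[->] //; rewrite ?ltxx// ltNge lee01.
Qed.

Lemma approx_sup_chi_exterior E x :
  density0 E x -> approx_sup mu (chi E) x = 0.
Proof.
move=> E0.
apply/eqP; rewrite eq_le; apply/andP; split; last first.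
  apply: le_ereal_inf_tmp => t /= tE; rewrite leNgt; apply/negP => t0.
  apply: (@density0TN x); apply: density0S tE => y _ /=.
  by apply: (lt_le_trans t0); case: (chi_cases E y) => -[->].
apply: ereal_inf_lbound => /=; apply: density0S E0 => y /=.
by case: (chi_cases E y) => -[-> //]; rewrite ltxx.
Qed.

Lemma approx_sup_chi_not_exterior E x :
  ~ density0 E x -> approx_sup mu (chi E) x = 1.
Proof.
move=> nE0.
apply/eqP; rewrite eq_le; apply/andP; split; last first.
  apply: le_ereal_inf_tmp => t /= tE; rewrite leNgt; apply/negP => t1.
  apply: nE0; apply: density0S tE => y /= Ey.
  by case: (chi_cases E y) => -[->].
apply: ereal_inf_lbound => /=; apply: density0S (density0_set0 x) => y /=.
by case: (chi_cases E y) => -[->] //; rewrite ?ltxx// ltNge lee01.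
Qed.

Lemma density0_not_interior E x : density0 E x -> ~ meas_interior mu E x.
Proof.
move=> E0 E1; have : (1 : \bar R) = 0 by exact: (cvg_unique _ E1 E0).
by move/eqP; rewrite onee_eq0.
Qed.

(** The recursion stops as soon as the current value reaches the upper
    approximate limit. *)
Lemma jump_value_const n (u : X -> \bar R) x c l :
  approx_inf mu u x = c -> approx_sup mu u x = c -> jump_value mu n u l x = c.
Proof.
rewrite /jump_value => uinf usup; case: ifP => // _.
by elim: l.-1 => [|k /= ->] //; rewrite usup ltxx.
Qed.

Lemma jump_value_first n (u : X -> \bar R) x : (1 < n)%N ->
  jump_value mu n u 1 x = approx_inf mu u x.
Proof. by case: n => [|[|n]]. Qed.

Lemma jump_value_last n (u : X -> \bar R) x :
  jump_value mu n u n x = approx_sup mu u x.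
Proof. by rewrite /jump_value eqxx. Qed.

End density.

Theorem proposition6p2 (R : realType) (X : completeMetricType R)
    (mu : {outer_measure set X -> \bar R}) (Cd CP lambda : R)
    (mu_regular : borel_regular mu)
    (mu_doubling : doubling mu Cd)
    (mu_poincare : poincare mu CP lambda)
    (gamma : R) (gamma_gt0 : (0 < gamma)%R) (gamma_le : (gamma <= 2^-1)%R)
    (gammaP : perimeter_density_bound mu gamma)
    (n : nat) (n_def : n = Num.truncn (gamma^-1)%R)
    (E : set X) (E_perimeter : finite_perimeter mu E)
    (eps : R) (eps_gt0 : (0 < eps)%R)
    (G : set X) (G_open : open G) (G_cap : Cap1 mu G < eps%:E)
    (jump_cvg : forall (y : nat -> X) (x : X),
       (forall k, ~ G (y k)) -> ~ G x -> y @ \oo --> x ->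
       forall l1 : nat, (1 <= l1 <= n)%N ->
         \big[mine/+oo]_(1 <= l2 < n.+1)
           `|jump_value mu n (chi E) l1 (y k)
             - jump_value mu n (chi E) l2 x| @[k --> \oo] --> 0) :
  [/\ rel_boundary (~` G) (meas_interior mu E) `<=` meas_boundary mu E `\` G,
      closed (rel_boundary (~` G) (meas_interior mu E)) &
      closed (meas_boundary mu E `\` G)].
Proof.
have [mE _] := E_perimeter.
(* With [n = 1] the only jump value would be the upper approximate limit. *)
have n1 : (1 < n)%N.
  rewrite n_def -ltnS -(@ltr_nat R); apply: le_lt_trans (truncnS_gt _).
  by rewrite -[2%:R]invrK lef_pV2 ?posrE// invr_gt0.
have n0 : (0 < n)%N by exact: ltnW.
have closed_notG : closed (~` G) by exact: open_closedC.
(* Off [G], a limit of points outside the measure theoretic interior is outside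
   it: the first jump value is [0] at those points, whereas all jump values at a
   point of the interior are [1]. *)
have notI x A : ~ G x -> A `<=` ~` G -> closure A x ->
    (forall y, A y -> ~ meas_interior mu E y) -> ~ meas_interior mu E x.
  move=> nGx AG clAx AI Ix.
  suff : (0 : R)%R = 1%R by apply/eqP; rewrite eq_sym oner_neq0.
  apply: (@const_value_in_limit _ _ n
    (jump_value mu n (chi E)) A x 1) clAx.
  - move=> y Ay yx; apply: jump_cvg => // k; exact/AG.
  - move=> y /AI nIy; rewrite jump_value_first//.
    exact: approx_inf_chi_not_interior mu_doubling _ _ _ nIy.
  - move=> m _; apply: jump_value_const.
      exact: approx_inf_chi_interior mu_doubling _ _ _ Ix.
    apply: approx_sup_chi_not_exterior => E0.
    exact: density0_not_interior Ix.
(* Likewise for the measure theoretic exterior, with the last jump value. *)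
have notO x A : ~ G x -> A `<=` ~` G -> closure A x ->
    (forall y, A y -> ~ density0 mu E y) ->
    ~ density0 mu E x.
  move=> nGx AG clAx AO Ox.
  suff : (1 : R)%R = 0%R by apply/eqP; rewrite oner_neq0.
  apply: (@const_value_in_limit _ _ n
    (jump_value mu n (chi E)) A x n) clAx.
  - move=> y Ay yx; apply: jump_cvg => //; last by rewrite n0 leqnn.
    by move=> k; exact/AG.
  - move=> y /AO nOy; rewrite jump_value_last//.
    exact: approx_sup_chi_not_exterior.
  - move=> m _; apply: jump_value_const; last first.
      exact: approx_sup_chi_exterior mu_doubling _ _ Ox.
    apply: (approx_inf_chi_not_interior mu_doubling) => //.
    exact: density0_not_interior.
split.
- rewrite rel_boundaryE => x [[nGx clI] clC]; split => //.
  apply/(meas_boundaryP mu_doubling) => //; split.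
    apply: notO clI _ => // y -[// Iy _] E0.
    exact: density0_not_interior Iy.
  by apply: notI clC _ => // y [].
- exact: closed_rel_boundary.
- move=> x clx; have nGx : ~ G x.
    by apply: closed_notG; apply: closure_subset clx => y [].
  split => //; apply/(meas_boundaryP mu_doubling) => //; split.
    apply: notO clx _ => // y -[//].
    by move=> /(meas_boundaryP mu_doubling _ mE)[].
  apply: notI clx _ => // y -[//].
  by move=> /(meas_boundaryP mu_doubling _ mE)[].
Qed.
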